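(* Let $\alpha,\beta,\gamma\in\widehat{\kappa^*}$ satisfy $(\alpha+\gamma,\varepsilon)=(\alpha,\gamma)=0$, and let $f\colon\widehat{\kappa^*}\to\mathbb{C}$ be any map. For all $x,y\in\kappa$ with $x\neq0,1$, \[ \sum_{\nu,\mu\in\widehat{\kappa^*}}f(\mu)\frac{(\alpha)_\nu(\gamma)_\nu(\beta\overline{\gamma})_\mu}{(\beta)^\circ_{\nu\mu}}\frac{\nu(x)\mu(y)}{(\varepsilon)^\circ_\nu(\varepsilon)^\circ_\mu} =\overline{\alpha}(1-x)\sum_{\eta\in\widehat{\kappa^*}}\frac{(\alpha+\beta\overline{\gamma})_\eta}{(\beta+\varepsilon)^\circ_\eta}\eta\!\left(\frac{x}{x-1}\right)\sum_{\mu\in\widehat{\kappa^*}}f(\mu)\frac{(\overline{\eta})_\mu}{(\overline{\alpha\eta}+\varepsilon)^\circ_\mu}\mu\!\left(\frac{y(x-1)}{x}\right) +(1-q)^2f(\overline{\beta}\gamma)(\varepsilon)^\circ_\beta(\alpha)_{\overline{\gamma}}\,\overline{\beta}(-y)\,\gamma\!\left(\frac yx\right). \]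
   Context: $\kappa$ is a finite field with $q$ elements; $\widehat{\kappa^*}=\mathrm{Hom}(\kappa^*,\mathbb{C}^* )$, written multiplicatively, characters extended by $\varphi(0)=0$; $\varepsilon$ trivial, $\overline{\varphi}=\varphi^{-1}$ (e.g. $\overline{\alpha\eta}=(\alpha\eta)^{-1}$). $\delta(\varphi)=1$ if $\varphi=\varepsilon$, else $0$. Fix a nontrivial additive character $\psi$; $g(\varphi)=-\sum_{x\in\kappa}\varphi(x)\psi(x)$, $g^\circ(\varphi)=q^{\delta(\varphi)}g(\varphi)$, $(\varphi)_\nu=g(\varphi\nu)/g(\varphi)$, $(\varphi)^\circ_\nu=g^\circ(\varphi\nu)/g^\circ(\varphi)$. $P$ is the free abelian monoid on $\widehat{\kappa^*}$ written additively, with symmetric bilinear pairing determined by $(\alpha,\beta)=\delta(\alpha\overline\beta)$ (so $(\alpha,\gamma)=0$ means $\alpha\ne\gamma$). For $\mathbf a=\alpha_1+\dots+\alpha_r$, $(\mathbf a)_\nu=\prod(\alpha_i)_\nu$, $(\mathbf a)^\circ_\nu=\prod(\alpha_i)^\circ_\nu$. *)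

(* Defs.v *)
From HB Require Import structures.
From mathcomp Require Import all_boot all_order all_algebra all_fingroup all_solvable all_field.
From mathcomp Require Import reals complex.

Set Implicit Arguments.
Unset Strict Implicit.
Unset Printing Implicit Defensive.

Import Order.TTheory GRing.Theory Num.Theory.
Local Open Scope ring_scope.

Section CharacterGroup.

Variables (F : finFieldType) (C : numClosedFieldType).

(* A map to C that is multiplicative and sends 1 to 1 takes nonzero values, so
   these are exactly the homomorphisms from the unit group of F to C^*. *)
Definition is_mchar (f : {ffun {unit F} -> C}) : bool :=
  (f 1%g == 1) && [forall u, forall v, f (u * v)%g == f u * f v].

Record mchar : predArgType :=
  MChar { mchar_ffun : {ffun {unit F} -> C}; _ : is_mchar mchar_ffun }.

HB.instance Definition _ := [isSub for mchar_ffun].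
HB.instance Definition _ := [Choice of mchar by <:].

Lemma mchar_valM (chi : mchar) u v :
  mchar_ffun chi (u * v)%g = mchar_ffun chi u * mchar_ffun chi v.
Proof. by case: chi => f /= /andP[_ /forallP/(_ u)/forallP/(_ v)/eqP]. Qed.

Lemma mchar_val1 (chi : mchar) : mchar_ffun chi 1%g = 1.
Proof. by case: chi => f /= /andP[/eqP]. Qed.

Lemma mchar_val_neq0 (chi : mchar) u : mchar_ffun chi u != 0.
Proof.
apply/eqP => h; have /eqP := mchar_val1 chi.
by rewrite -(mulgV u) mchar_valM h mul0r eq_sym oner_eq0.
Qed.

Lemma mchar_valX (chi : mchar) u n :
  mchar_ffun chi (u ^+ n)%g = mchar_ffun chi u ^+ n.
Proof.
elim: n => [|n IHn]; first by rewrite expg0 mchar_val1 expr0.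
by rewrite expgS mchar_valM IHn exprS.
Qed.

(* Finiteness: the values of a character are roots of 'X^#|[set: {unit F}]| - 1. *)
Definition mchar_values : seq C :=
  sval (closed_field_poly_normal ('X^#|[set: {unit F}]| - 1%:P : {poly C})).

Lemma mem_mchar_values (chi : mchar) u : mchar_ffun chi u \in mchar_values.
Proof.
rewrite /mchar_values; case: closed_field_poly_normal => r /= def_p.
have n_gt0 : (0 < #|[set: {unit F}]|)%N by exact: cardG_gt0.
have: root ('X^#|[set: {unit F}]| - 1%:P) (mchar_ffun chi u).
  rewrite rootE !hornerE -mchar_valX.
  by rewrite expg_cardG ?inE ?mchar_val1 ?subrr.
rewrite {1}def_p rootZ ?root_prod_XsubC //.
by rewrite lead_coef_eq0 -size_poly_eq0 size_XnsubC.
Qed.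

Definition mchar_code (chi : mchar) :
    {ffun {unit F} -> 'I_(size mchar_values).+1} :=
  [ffun u => inord (index (mchar_ffun chi u) mchar_values)].

Definition mchar_decode (k : {ffun {unit F} -> 'I_(size mchar_values).+1}) :
    option mchar :=
  insub [ffun u => mchar_values`_(k u)].

Lemma mchar_codeK : pcancel mchar_code mchar_decode.
Proof.
move=> chi; rewrite /mchar_decode -[RHS](valK chi); congr insub.
apply/ffunP=> u; rewrite !ffunE inordK ?ltnS ?index_size //.
by rewrite nth_index // mem_mchar_values.
Qed.

HB.instance Definition _ : isCountable mchar := PCanIsCountable mchar_codeK.
HB.instance Definition _ : isFinite mchar := PCanIsFinite mchar_codeK.

Lemma mchar_one_subproof : is_mchar [ffun=> 1].
Proof.
apply/andP; split; first by rewrite ffunE.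
by apply/forallP=> u; apply/forallP=> v; rewrite !ffunE mulr1.
Qed.

Lemma mchar_mul_subproof (chi phi : mchar) :
  is_mchar [ffun u => mchar_ffun chi u * mchar_ffun phi u].
Proof.
apply/andP; split; first by rewrite ffunE !mchar_val1 mulr1.
by apply/forallP=> u; apply/forallP=> v; rewrite !ffunE !mchar_valM mulrACA.
Qed.

Lemma mchar_inv_subproof (chi : mchar) :
  is_mchar [ffun u => (mchar_ffun chi u)^-1].
Proof.
apply/andP; split; first by rewrite ffunE mchar_val1 invr1.
by apply/forallP=> u; apply/forallP=> v; rewrite !ffunE mchar_valM invfM.
Qed.

Definition mchar_one : mchar := MChar mchar_one_subproof.
Definition mchar_mul (chi phi : mchar) : mchar :=
  MChar (mchar_mul_subproof chi phi).
Definition mchar_inv (chi : mchar) : mchar := MChar (mchar_inv_subproof chi).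

Lemma mchar_mulA : associative mchar_mul.
Proof. by move=> a b c; apply/val_inj/ffunP=> u; rewrite !ffunE mulrA. Qed.

Lemma mchar_mul1 : left_id mchar_one mchar_mul.
Proof. by move=> a; apply/val_inj/ffunP=> u; rewrite !ffunE mul1r. Qed.

Lemma mchar_mulV : left_inverse mchar_one mchar_inv mchar_mul.
Proof.
by move=> a; apply/val_inj/ffunP=> u; rewrite !ffunE mulVf ?mchar_val_neq0.
Qed.

HB.instance Definition _ :=
  Finite_isGroup.Build mchar mchar_mulA mchar_mul1 mchar_mulV.

Definition mchar_ext (chi : mchar) (x : F) : C :=
  if insub x : option {unit F} is Some u then mchar_ffun chi u else 0.

End CharacterGroup.

Coercion mchar_ext : mchar >-> Funclass.

Section GaussSums.

Variables (F : finFieldType) (C : numClosedFieldType).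
Local Notation X := (mchar F C).
Implicit Types (psi : F -> C) (phi nu : X).

Definition is_additive_char psi : Prop :=
  psi 0 = 1 /\ (forall x y, psi (x + y) = psi x * psi y).

Definition delta phi : nat := (phi == 1%g).

Definition gauss psi phi : C := - \sum_(x : F) phi x * psi x.

Definition gauss_o psi phi : C := #|F|%:R ^+ delta phi * gauss psi phi.

Definition poch psi phi nu : C := gauss psi (phi * nu)%g / gauss psi phi.

Definition poch_o psi phi nu : C := gauss_o psi (phi * nu)%g / gauss_o psi phi.

(* The free abelian monoid on the finite set of characters: a function gives
   the multiplicity of each character. *)
Definition charmon := {ffun X -> nat}.

Definition pgen phi : charmon := [ffun chi => (chi == phi : nat)].

Definition pairing (a b : charmon) : nat :=
  (\sum_(chi : X) \sum_(phi : X) a chi * b phi * delta (chi * phi^-1)%g)%N.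

Definition mpoch psi (a : charmon) nu : C :=
  \prod_(chi : X) poch psi chi nu ^+ a chi.

Definition mpoch_o psi (a : charmon) nu : C :=
  \prod_(chi : X) poch_o psi chi nu ^+ a chi.

End GaussSums.

(* Main.v *)
(* Both sides are linear in f, so the identity can be compared one mu at a time.
   The reflection formula g(phi) g_o(phi^-1) = phi(-1) q turns every Pochhammer
   denominator into a Gauss sum; with b = beta mu, and after the shift
   eta -> eta mu on the right, the two mu-terms become the hypergeometric sums
   2F1(alpha, gamma; b; x) and 2F1(alpha, b gamma^-1; b; x / (x - 1)).
   Writing products of two Gauss sums as Jacobi sums and summing over nu gives
   the finite-field Euler integral, for which Pfaff's transformation is the
   substitution t -> 1/t.  Gauss sums and Jacobi sums fail to match only when
   b = gamma; that single mu contributes the extra term. *)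

Require Import Defs.
From mathcomp Require Import all_boot all_order all_algebra all_fingroup all_solvable all_field.
From mathcomp Require Import reals complex.
From mathcomp Require Import ring.

Import Order.TTheory GRing.Theory Num.Theory.
Local Open Scope ring_scope.

(** In characteristic 0 the polynomial ['X^n - 1] is separable, so its factorisation lists [n]
    distinct roots of unity, enough for [has_prim_root]. *)
Lemma closed_prim_root (C : numClosedFieldType) n :
  (0 < n)%N -> exists z : C, n.-primitive_root z.
Proof.
move=> n_gt0; have [r Dp] := closed_field_poly_normal ('X^n - 1 : {poly C}).
rewrite (monicP _) ?monicXnsubC // scale1r in Dp.
have rn1: all n.-unity_root r by apply/allP=> z; rewrite -root_prod_XsubC -Dp.
have sz_r: (n < (size r).+1)%N.
  by rewrite -(size_prod_XsubC r id) -Dp size_XnsubC.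
have [|z] := hasP (has_prim_root n_gt0 rn1 _ sz_r); last by exists z.
by rewrite -separable_prod_XsubC -Dp separable_Xn_sub_1 // pnatr_eq0 -lt0n.
Qed.

Set Implicit Arguments.
Unset Strict Implicit.

(** * Characters extended by zero and their orthogonality *)

Section Characters.

Variables (F : finFieldType) (C : numClosedFieldType).
Local Notation X := (mchar F C).
Local Notation q := (#|F|%:R : C).
Implicit Types (chi phi nu : X) (x y z : F).

Lemma mchar_ext_unit chi (u : {unit F}) : chi (val u) = mchar_ffun chi u.
Proof. by rewrite /mchar_ext valK. Qed.

Lemma mchar_ext0 chi : chi 0 = 0.
Proof. by rewrite /mchar_ext insubF // unitr0. Qed.

Lemma unit_of_neq0 x : x != 0 -> {u : {unit F} | x = val u}.
Proof. by rewrite -unitfE => ux; exists (FinRing.Unit ux). Qed.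

Lemma mchar_extM chi x y : chi (x * y) = chi x * chi y.
Proof.
have [->|/unit_of_neq0[u ->]] := eqVneq x 0; first by rewrite mul0r mchar_ext0 mul0r.
have [->|/unit_of_neq0[v ->]] := eqVneq y 0; first by rewrite mulr0 mchar_ext0 mulr0.
by rewrite !mchar_ext_unit -mchar_valM -mchar_ext_unit.
Qed.

Lemma mchar_ext1 chi : chi 1 = 1.
Proof. by rewrite -(mchar_val1 chi) -mchar_ext_unit. Qed.

Lemma mchar_ext_eq0 chi x : (chi x == 0) = (x == 0).
Proof.
have [->|/unit_of_neq0[u ->]] := eqVneq x 0; first by rewrite mchar_ext0 eqxx.
by rewrite mchar_ext_unit (negPf (mchar_val_neq0 _ _)).
Qed.

Lemma mchar_extV chi x : chi x^-1 = (chi x)^-1.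
Proof.
have [->|x0] := eqVneq x 0; first by rewrite invr0 mchar_ext0 invr0.
apply: (mulfI (x := chi x)); rewrite ?mchar_ext_eq0 //.
by rewrite -mchar_extM !divff ?mchar_ext1 ?mchar_ext_eq0.
Qed.

Lemma mcharM chi phi x : (chi * phi)%g x = chi x * phi x.
Proof.
have [->|/unit_of_neq0[u ->]] := eqVneq x 0; first by rewrite !mchar_ext0 mulr0.
by rewrite !mchar_ext_unit ffunE.
Qed.

Lemma mcharV chi x : (chi^-1)%g x = (chi x)^-1.
Proof.
have [->|/unit_of_neq0[u ->]] := eqVneq x 0; first by rewrite !mchar_ext0 invr0.
by rewrite !mchar_ext_unit ffunE.
Qed.

Lemma mchar1 x : (1%g : X) x = (x != 0)%:R.
Proof.
have [->|/unit_of_neq0[u ->]] := eqVneq x 0; first by rewrite !mchar_ext0.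
by rewrite !mchar_ext_unit ffunE.
Qed.

Lemma mchar_eqP chi phi : (forall x, x != 0 -> chi x = phi x) -> chi = phi.
Proof.
move=> e; apply/val_inj/ffunP => u; rewrite /= -!mchar_ext_unit e //.
by rewrite -unitfE (valP u).
Qed.

Lemma mcharC chi phi : (chi * phi = phi * chi)%g.
Proof. by apply: mchar_eqP => x _; rewrite !mcharM mulrC. Qed.

Lemma mcharVM chi phi : ((chi * phi)^-1 = chi^-1 * phi^-1)%g.
Proof. by rewrite invMg mcharC. Qed.

Lemma mcharN1_sqr chi : chi (-1) * chi (-1) = 1.
Proof. by rewrite -mchar_extM mulrNN mulr1 mchar_ext1. Qed.

Lemma mcharN1V chi : (chi (-1))^-1 = chi (-1).
Proof. by rewrite -mchar_extV invrN1. Qed.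

Lemma mcharN chi x : chi (- x) = chi (-1) * chi x.
Proof. by rewrite -mchar_extM mulN1r. Qed.

Lemma sum_mchar chi : \sum_x chi x = (q - 1) * (chi == 1%g)%:R.
Proof.
have [->|chi1] := eqVneq chi 1%g.
  rewrite mulr1 -sum1_card natr_sum [RHS](_ : _ = \sum_(x : F | x != 0) 1); last first.
    by rewrite (bigD1 0) //= addrAC subrr add0r.
  rewrite (bigD1 0) //= mchar_ext0 add0r.
  by apply: eq_bigr => x x0; rewrite mchar1 x0.
have [a a0 chia] : exists2 a, a != 0 & chi a != 1.
  apply/exists_inP; apply: contraNT chi1; rewrite negb_exists_in => /forall_inP h.
  by apply/eqP/mchar_eqP => x x0; rewrite mchar1 x0; apply/eqP; rewrite -[_ == _]negbK h.
rewrite mulr0; apply/eqP.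
have : (chi a - 1) * (\sum_x chi x) == 0.
  rewrite mulrBl mul1r subr_eq0 mulr_sumr; apply/eqP.
  rewrite [RHS](reindex_inj (mulfI a0)) /=.
  by apply: eq_bigr => x _; rewrite mchar_extM.
by rewrite mulf_eq0 subr_eq0 (negPf chia).
Qed.

(** One character separates all units from 1: it sends a generator of the cyclic unit group to a
    root of unity of the same order. *)
Lemma mchar_separates x : x != 0 -> x != 1 -> exists chi : X, chi x != 1.
Proof.
case/unit_of_neq0=> u ->{x} u1.
have /cyclicP[g Dg] := field_unit_group_cyclic [group of [set: {unit F}]].
have log_ex v : exists k, (g ^+ k)%g == v.
  have : v \in <[g]>%g by rewrite -Dg inE.
  by case/cycleP => k ->; exists k.
pose d v := ex_minn (log_ex v).
have dK v : (g ^+ d v)%g = v by rewrite /d; case: ex_minnP => k /eqP.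
have [z z_prim] := closed_prim_root C _ (order_gt0 g).
(* [z] and [g] have the same order, so [z ^+ d v] does not depend on which logarithm of [v] is
   picked. *)
have chiP : is_mchar [ffun v => z ^+ d v].
  apply/andP; split.
    rewrite ffunE -[1](expr0 z) (eq_prim_root_expr z_prim).
    by rewrite -eq_expg_mod_order dK expg0.
  apply/forallP => v; apply/forallP => w; rewrite !ffunE -exprD.
  by rewrite (eq_prim_root_expr z_prim) -eq_expg_mod_order expgD !dK.
exists (MChar chiP); rewrite mchar_ext_unit ffunE.
apply: contraNneq u1 => /eqP; rewrite -[1](expr0 z) (eq_prim_root_expr z_prim).
by rewrite -eq_expg_mod_order dK expg0 => /eqP ->.
Qed.

Lemma sum_mchar_dual_neq1 x : x != 1 -> \sum_(chi : X) chi x = 0.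
Proof.
move=> x1; have [->|x0] := eqVneq x 0; first by rewrite big1 // => chi _; rewrite mchar_ext0.
have [phi phix] := mchar_separates x0 x1.
apply/eqP; have : (phi x - 1) * (\sum_(chi : X) chi x) == 0.
  rewrite mulrBl mul1r subr_eq0 mulr_sumr; apply/eqP.
  rewrite [RHS](reindex_inj (mulgI phi)) /=.
  by apply: eq_bigr => chi _; rewrite mcharM.
by rewrite mulf_eq0 subr_eq0 (negPf phix).
Qed.

(* At x = 1 this counts the characters: compute the sum of chi x over all pairs
   (chi, x) in both orders. *)
Lemma sum_mchar_dual x : \sum_(chi : X) chi x = (q - 1) * (x == 1)%:R.
Proof.
have [->|x1] := eqVneq x 1; last by rewrite mulr0 sum_mchar_dual_neq1.
have : \sum_(chi : X) \sum_x chi x = q - 1.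
  rewrite (bigD1 1%g) //= sum_mchar eqxx mulr1 big1 ?addr0 // => chi chi1.
  by rewrite sum_mchar (negPf chi1) mulr0.
rewrite exchange_big (bigD1 1) //= [X in _ + X]big1 => [|y y1].
  by rewrite addr0 mulr1.
exact: sum_mchar_dual_neq1.
Qed.

(** * Jacobi sums and the finite-field Euler integral *)

Definition jacobi chi phi : C := \sum_x chi x * phi (1 - x).

(** The substitution [t = x / (1 - x)] gives the sum of [chi] over all [t] except [-1], whence the
    subtracted [chi (-1)]. *)
Lemma jacobiV chi : jacobi chi (chi^-1)%g = (q - 1) * (chi == 1%g)%:R - chi (-1).
Proof.
rewrite -sum_mchar [in RHS](bigD1 (-1)) //= addrC addrK.
rewrite /jacobi (bigD1 1) //= subrr mchar_ext0 mulr0 add0r.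
rewrite [RHS](reindex_onto (fun x => x / (1 - x)) (fun t => t / (1 + t))) /=; last first.
  move=> t tN1; have t1 : 1 + t != 0 by rewrite addrC addr_eq0.
  by field; rewrite t1 addrK oner_eq0.
apply: eq_big => [x|x x1]; last by rewrite mcharV -mchar_extV mchar_extM.
(* At [x = 1] division by zero gives [t = 0], which maps back to 0 rather than 1, so the reindexing
   drops this point on both sides. *)
have [->|x1] /= := eqVneq x 1.
  by rewrite subrr invr0 mulr0 mul0r [0 == 1]eq_sym oner_eq0 andbF.
have x1' : 1 - x != 0 by rewrite subr_eq0 eq_sym.
have e : 1 + x / (1 - x) = (1 - x)^-1 by field.
rewrite e; apply/esym/andP; split; last by rewrite invrK divfK.
by rewrite -addr_eq0 addrC e invr_eq0.
Qed.

(* The character sum forces s z = 1 - s, i.e. s = (1 + z)^-1. *)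
Lemma sum_jacobi_mchar (a : X) z : z != 0 ->
  \sum_(nu : X) jacobi (a * nu)%g (nu^-1)%g * nu z = (q - 1) * (a^-1)%g (1 + z).
Proof.
move=> z0; under eq_bigr do rewrite /jacobi mulr_suml.
rewrite exchange_big /=.
transitivity (\sum_s (q - 1) * (a s * (s / (1 - s) * z == 1)%:R)).
  apply: eq_bigr => s _; rewrite mulrCA -sum_mchar_dual mulr_sumr.
  by apply: eq_bigr => nu _; rewrite mcharM mcharV !mchar_extM mchar_extV !mulrA.
rewrite -mulr_sumr; congr (_ * _).
(* True at [s = 1] too: division by zero turns the left side into [0 == 1], and the right side fails
   because [z != 0]. *)
have sE s : (s / (1 - s) * z == 1) = (s * (1 + z) == 1).
  have [->|s1] := eqVneq s 1.
    by rewrite subrr invr0 mulr0 mul0r mul1r eq_sym oner_eq0 -subr_eq0 addrC addKr (negPf z0).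
  have s1' : 1 - s != 0 by rewrite subr_eq0 eq_sym.
  rewrite -(inj_eq (mulIf s1')) mul1r -subr_eq0 -[RHS]subr_eq0; congr (_ == 0).
  by field.
rewrite mcharV -mchar_extV; have [z1|z1] := eqVneq (1 + z) 0.
  rewrite z1 invr0 mchar_ext0 big1 // => s _.
  by rewrite sE z1 mulr0 eq_sym oner_eq0 mulr0.
rewrite (bigD1 (1 + z)^-1) //= sE mulVf // eqxx mulr1 big1 ?addr0 // => s sz.
rewrite sE (_ : _ == 1 = false) ?mulr0 //; apply: contraNF sz => /eqP e.
by rewrite -[s](mulfK z1) e mul1r.
Qed.

(* The Euler integral of the hypergeometric function 2F1(a, c; b; x), based at
   the point 1. *)
Definition euler (a c b : X) x : C :=
  \sum_t c t * (a * b^-1)%g (1 - t) * (a^-1)%g (1 - (1 - x) * t).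

(** Only the second Jacobi sum is expanded. For each [t] the sum over [nu] is then
    [sum_jacobi_mchar] at [z = t / (1 - t) * x], and [1 + z] yields the last factor of [euler]. *)
Lemma sum_jacobi2 (a c b : X) x : x != 0 ->
  \sum_(nu : X) jacobi (a * nu)%g (nu^-1)%g * jacobi (c * nu)%g ((b * nu)^-1)%g * nu x
  = (q - 1) * euler a c b x.
Proof.
move=> x0; under eq_bigr do rewrite /jacobi -/(jacobi _ _) mulrAC mulr_sumr.
rewrite exchange_big mulr_sumr /=; apply: eq_bigr => t _.
transitivity (c t * (b^-1)%g (1 - t) * \sum_(nu : X)
   jacobi (a * nu)%g (nu^-1)%g * nu (t / (1 - t) * x)).
  rewrite mulr_sumr; apply: eq_bigr => nu _.
  by rewrite !mcharVM !mcharM !mcharV !mchar_extM mchar_extV; ring.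
have [->|t0] := eqVneq t 0; first by rewrite mchar_ext0 !mul0r mulr0.
have [->|t1] := eqVneq t 1; first by rewrite subrr !mchar_ext0 ?(mulr0, mul0r).
have t1' : 1 - t != 0 by rewrite subr_eq0 eq_sym.
rewrite sum_jacobi_mchar ?mulf_neq0 ?invr_eq0 //.
have -> : 1 + t / (1 - t) * x = (1 - (1 - x) * t) / (1 - t) by field.
by rewrite !mcharM !mcharV !mchar_extM mchar_extV invfM invrK; ring.
Qed.

(** Under [t -> 1 / t] the powers of [t] collect to [b * c^-1], and the signs to [b (-1)] because
    [a (-1)] occurs twice. The point 0 is fixed and contributes nothing. *)
Lemma euler_pfaff (a c b : X) x : x != 1 ->
  euler a c b x =
  b (-1) * (a^-1)%g (1 - x) * euler a (b * c^-1)%g b (x / (x - 1)).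
Proof.
move=> x1; have x1' : 1 - x != 0 by rewrite subr_eq0 eq_sym.
have x1'' : x - 1 != 0 by rewrite subr_eq0.
rewrite /euler (reindex_inj (can_inj (@invrK F))) mulr_sumr; apply: eq_bigr => t _.
have [->|t0] := eqVneq t 0; first by rewrite invr0 !mchar_ext0 !mul0r mulr0.
have -> : 1 - t^-1 = - 1 * (1 - t) / t by field.
have -> : 1 - (1 - x) * t^-1 = -1 * (1 - x - t) / t by field.
have -> : 1 - (1 - x / (x - 1)) * t = (1 - x - t) / (1 - x) by field; rewrite x1' x1''.
rewrite !mcharM !mcharV !mchar_extM !mchar_extV.
have a0 := mchar_ext_eq0 a t; have b0 := mchar_ext_eq0 b t.
have ax0 := mchar_ext_eq0 a (1 - x).
rewrite !invfM !invrK !mcharN1V.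
transitivity ((a (-1) * a (-1)) * (b (-1) * (a (1 - t) * (b (1 - t))^-1) * (b t / c t)
   * (a (1 - x - t))^-1) * ((a t) / (a t))); first by ring.
rewrite mcharN1_sqr divff ?a0 // mulr1 mul1r.
transitivity (b (-1) * (a (1 - t) / b (1 - t)) * (b t / c t) / a (1 - x - t)
  * (a (1 - x) / a (1 - x))); first by rewrite divff ?ax0 // mulr1.
ring.
Qed.

(** The trivial character only removes [t = 0], where the other factors equal 1; this is the final
    [- 1]. The completed sum becomes a Jacobi sum under [t = 1 - x * r]. Needed for the degenerate
    case of [hyp_gauss_pfaff]. *)
Lemma euler1 (a b : X) x : x != 0 -> x != 1 ->
  euler a 1%g b (x / (x - 1)) =
  (b^-1)%g x * a (-1) * a (1 - x) * jacobi (a * b^-1)%g (a^-1)%g - 1.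
Proof.
move=> x0 x1; have x1' : 1 - x != 0 by rewrite subr_eq0 eq_sym.
have x1'' : x - 1 != 0 by rewrite subr_eq0.
rewrite /euler (bigD1 0) //= mchar_ext0 !mul0r add0r.
pose h t := (a * b^-1)%g (1 - t) * (a^-1)%g (1 - (1 - x / (x - 1)) * t).
transitivity (\sum_(t | t != 0) h t).
  by apply: eq_bigr => t t0; rewrite mchar1 t0 mul1r.
apply/(addIr 1); rewrite subrK.
transitivity (\sum_t h t).
  rewrite [RHS](bigD1 0) //= addrC; congr (_ + _).
  by rewrite /h mulr0 subr0 !mchar_ext1 mulr1.
have hinj : injective (fun r => 1 - x * r) by move=> r s /addrI/oppr_inj/(mulfI x0).
rewrite (reindex_inj hinj) /jacobi mulr_sumr; apply: eq_bigr => r _; rewrite /h.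
have -> : 1 - (1 - x * r) = x * r by ring.
have -> : 1 - (1 - x / (x - 1)) * (1 - x * r) = - 1 * x * (1 - r) / (1 - x).
  by field; rewrite x1' x1''.
rewrite !mcharM !mcharV !mchar_extM !mchar_extV !invfM !invrK !mcharN1V.
transitivity ((b x)^-1 * a (-1) * a (1 - x) * (a r / b r / a (1 - r)) * (a x / a x)).
  by ring.
by rewrite divff ?mchar_ext_eq0 // mulr1; ring.
Qed.

End Characters.

(** * Gauss sums, the reflection formula and Pfaff's transformation *)

Section GaussSums.

Variables (F : finFieldType) (C : numClosedFieldType) (psi : F -> C).
Hypothesis psi_char : is_additive_char psi.
Hypothesis psi_nontrivial : exists a, psi a <> 1.
Local Notation X := (mchar F C).
Local Notation q := (#|F|%:R : C).
Local Notation G := (gauss psi).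
Local Notation Go := (gauss_o psi).
Implicit Types (a b c chi phi nu mu : X) (x y : F).

Lemma card_field_neq0 : q != 0.
Proof. by rewrite pnatr_eq0 -lt0n; apply/card_gt0P; exists 0. Qed.

Lemma sum_additive_char : \sum_x psi x = 0.
Proof.
have [_ psiD] := psi_char; have [a /eqP psia] := psi_nontrivial.
apply/eqP; have : (psi a - 1) * (\sum_x psi x) == 0.
  rewrite mulrBl mul1r subr_eq0 mulr_sumr; apply/eqP.
  rewrite [RHS](reindex_inj (addrI a)) /=.
  by apply: eq_bigr => x _; rewrite psiD.
by rewrite mulf_eq0 subr_eq0 (negPf psia).
Qed.

Lemma gauss1 : G 1%g = 1.
Proof.
have [psi0 _] := psi_char.
rewrite /gauss (bigD1 0) //= mchar_ext0 mul0r add0r.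
apply/(addIr (- 1)); rewrite subrr -opprD -[X in _ + X]psi0 addrC.
transitivity (- \sum_x psi x); last by rewrite sum_additive_char oppr0.
rewrite [in RHS](bigD1 0) //=; congr (- (_ + _)).
by apply: eq_bigr => x x0; rewrite mchar1 x0 mul1r.
Qed.

(** The double sum is grouped by the total [u] of the two arguments. Rescaling by [u != 0] gives a
    Jacobi sum; the slice [u = 0] is a complete character sum, nonzero only for trivial
    [chi * phi]. *)
Lemma gaussM chi phi :
  G chi * G phi = - G (chi * phi)%g * jacobi chi phi
                  + phi (-1) * (q - 1) * ((chi * phi)%g == 1%g)%:R.
Proof.
have [psi0 psiD] := psi_char.
rewrite /gauss mulrNN opprK mulr_suml.
transitivity (\sum_u psi u * \sum_x chi x * phi (u - x)).
  under eq_bigr => x _.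
    rewrite mulr_sumr (reindex_inj (addIr (- x))) /=.
    over.
  rewrite exchange_big; apply: eq_bigr => u _; rewrite mulr_sumr.
  apply: eq_bigr => x _; rewrite -[in RHS](subrK x u) [in RHS]addrK [in RHS]psiD.
  ring.
rewrite (bigD1 0) //= psi0 mul1r addrC; congr (_ + _); last first.
  rewrite -mulrA -sum_mchar mulr_sumr; apply: eq_bigr => x _.
  by rewrite sub0r mcharN mcharM; ring.
rewrite [in RHS](bigD1 0) //= mchar_ext0 mul0r add0r mulr_suml.
apply: eq_bigr => u u0; rewrite mulrAC mulrC; congr (_ * _).
rewrite (reindex_inj (mulfI u0)) /jacobi mulr_sumr; apply: eq_bigr => x _.
by rewrite -[X in phi (X - _)]mulr1 -mulrBr !mchar_extM mcharM mulrACA.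
Qed.

(** The power of [q] in [gauss_o] is what makes the reflection formula uniform: without it the
    product for trivial [chi] would be 1. *)
Lemma gaussV chi : G chi * Go (chi^-1)%g = chi (-1) * q.
Proof.
rewrite /gauss_o mulrCA gaussM mulgV gauss1 eqxx jacobiV mulr1 mcharV mcharN1V.
rewrite /delta invg_eq1; case: eqP => [->|_].
  by rewrite expr1 mchar1 oppr_eq0 oner_eq0; ring.
by rewrite expr0 /=; ring.
Qed.

Lemma gauss_neq0 chi : G chi != 0.
Proof.
have : G chi * Go (chi^-1)%g != 0.
  by rewrite gaussV mulf_neq0 ?card_field_neq0 // mchar_ext_eq0 oppr_eq0 oner_eq0.
by rewrite mulf_eq0 negb_or => /andP[].
Qed.

Lemma gauss_o_neq0 chi : Go chi != 0.
Proof. by rewrite mulf_neq0 ?expf_neq0 ?gauss_neq0 ?card_field_neq0. Qed.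

Lemma gauss_oV chi : (Go chi)^-1 = chi (-1) * G (chi^-1)%g / q.
Proof.
have := gaussV (chi^-1)%g; rewrite invgK mcharV mcharN1V => e.
have q0 := card_field_neq0.
apply: (mulfI (gauss_o_neq0 chi)); rewrite divff ?gauss_o_neq0 // mulrA [_ * (_ * _)]mulrCA [Go chi * _]mulrC e.
by rewrite mulrA mcharN1_sqr mul1r divff.
Qed.

Lemma gauss_o1 : Go 1%g = q.
Proof. by rewrite /gauss_o /delta eqxx gauss1 mulr1 expr1. Qed.

Lemma gauss_o_neq1 chi : chi != 1%g -> Go chi = G chi.
Proof. by rewrite /gauss_o /delta => /negPf ->; rewrite expr0 mul1r. Qed.

(* Up to a constant factor, 2F1(a, c; b; x) with its denominators moved to the
   numerator by the reflection formula [gaussV]. *)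
Definition hyp_gauss a c b x : C :=
  \sum_nu G (a * nu)%g * G (c * nu)%g * G ((b * nu)^-1)%g * G (nu^-1)%g * nu x.

(** Pairing [a * nu] with [nu^-1] and [c * nu] with [(b * nu)^-1] makes both product characters
    independent of [nu]. Since [a] is nontrivial, only the second pair can leave a correction, when
    [c = b]; it sums by [sum_jacobi_mchar] at [- x]. *)
Lemma hyp_gauss_euler a c b x : a != 1%g -> x != 0 ->
  hyp_gauss a c b x =
  (q - 1) * G a * G (c * b^-1)%g * euler a c b x
  - (q - 1) ^+ 2 * G a * b (-1) * (a^-1)%g (1 - x) * (c == b)%:R.
Proof.
move=> a1 x0.
transitivity (\sum_nu (G a * G (c * b^-1)%g *
     (jacobi (a * nu)%g (nu^-1)%g * jacobi (c * nu)%g ((b * nu)^-1)%g * nu x)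
   - G a * b (-1) * (q - 1) * (c == b)%:R
       * (jacobi (a * nu)%g (nu^-1)%g * nu (- x)))).
  apply: eq_bigr => nu _.
  transitivity ((G (a * nu)%g * G (nu^-1)%g) * (G (c * nu)%g * G ((b * nu)^-1)%g) * nu x).
    ring.
  rewrite (gaussM (a * nu)%g) (gaussM (c * nu)%g) mulgK (negPf a1) mulr0 addr0.
  have -> : ((c * nu) * (b * nu)^-1 = c * b^-1)%g.
    by rewrite invMg mulgA mulgK.
  have -> : ((c * b^-1)%g == 1%g) = (c == b).
    by rewrite -(inj_eq (mulIg b)) mulgKV mul1g.
  rewrite mcharV mcharM invfM !mcharN1V [nu (- x)]mcharN; ring.
rewrite sumrB -!mulr_sumr sum_jacobi2 // sum_jacobi_mchar ?oppr_eq0 //.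
ring.
Qed.

Lemma hyp_gauss_pfaff a c b x :
  a != 1%g -> c != 1%g -> x != 0 -> x != 1 ->
  hyp_gauss a c b x * G (b * c^-1)%g =
  (a^-1)%g (1 - x) * G c * hyp_gauss a (b * c^-1)%g b (x / (x - 1))
  + (q - 1) ^+ 2 * (c^-1)%g x * G (a * c^-1)%g * G c * (b == c)%:R.
Proof.
move=> a1 c1 x0 x1; have x1' : x - 1 != 0 by rewrite subr_eq0.
have q0 := card_field_neq0.
rewrite !hyp_gauss_euler ?mulf_neq0 ?invr_eq0 //.
have -> : ((b * c^-1)%g == b) = false.
  apply: contraNF c1 => /eqP e; rewrite -invg_eq1; apply/eqP.
  by apply: (mulgI b); rewrite e mulg1.
have -> : (b * c^-1 * b^-1 = c^-1)%g by rewrite [(b * _)%g]mcharC mulgK.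
rewrite euler_pfaff // mulr0 subr0 [c == b]eq_sym.
have Gc : G c * G (c^-1)%g = c (-1) * q by rewrite -gaussV gauss_o_neq1 // invg_eq1.
(* When [b = c], the right-hand Euler integral has trivial middle character and [euler1] evaluates
   it. *)
have [->|bc] := eqVneq b c.
  rewrite !mulgV gauss1 euler1 // !mulr1.
  have := gaussM (a * c^-1)%g (a^-1)%g.
  rewrite [(a * c^-1 * _)%g]mcharC mulKg invg_eq1 (negPf c1) mulr0 addr0.
  have Ga : G a * G (a^-1)%g = a (-1) * q by rewrite -gaussV gauss_o_neq1 // invg_eq1.
  set J := jacobi _ _; move=> GJ.
  (* Comes from [GJ] and reflection, after multiplying by the nonzero [q] and [G (c^-1)]. *)
  have TJ : c (-1) * G a * J = - a (-1) * G (a * c^-1)%g * G c.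
    apply: (mulIf q0); apply: (mulIf (gauss_neq0 (c^-1)%g)).
    transitivity (- (c (-1) * q) * G a * (- G (c^-1)%g * J)); first by ring.
    rewrite -GJ -Gc.
    transitivity (- (G a * G (a^-1)%g) * G c * G (c^-1)%g * G (a * c^-1)%g); first by ring.
    by rewrite Ga; ring.
  have mk : (a^-1)%g (1 - x) * a (1 - x) = 1.
    by rewrite mcharV mulVf // mchar_ext_eq0 subr_eq0 eq_sym.
  set E := _ * J - 1.
  (* The left side lacks the factor [q] that [Gc] supplies on the right. This gap and the correction
     of [hyp_gauss_euler] combine into a multiple of [E + 1], a pure Jacobi term. *)
  transitivity ((q - 1) * G a * (c (-1) * q) * (a^-1)%g (1 - x) * E
    - (q - 1) ^+ 2 * (c^-1)%g x * a (-1) * ((a^-1)%g (1 - x) * a (1 - x))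
        * (c (-1) * G a * J)); first by rewrite /E; ring.
  rewrite mk TJ -Gc.
  transitivity ((q - 1) * G a * (G c * G (c^-1)%g) * (a^-1)%g (1 - x) * E
    + (q - 1) ^+ 2 * (c^-1)%g x * G (a * c^-1)%g * G c * (a (-1) * a (-1))).
    by ring.
  by rewrite mcharN1_sqr; ring.
have Gbc : G (c * b^-1)%g * G (b * c^-1)%g = b (-1) * c (-1) * q.
  have := gaussV (c * b^-1)%g.
  rewrite invMg invgK gauss_o_neq1 ?mcharM ?mcharV ?mcharN1V; last first.
    by apply: contraNneq bc => e; rewrite -[b](mulgKV c) e mul1g.
  by move=> ->; rewrite [c _ * _]mulrC.
rewrite !mulr0 subr0 addr0.
set E := euler _ _ _ _.
transitivity ((q - 1) * G a * (G (c * b^-1)%g * G (b * c^-1)%g) *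
   b (-1) * (a^-1)%g (1 - x) * E); first by ring.
rewrite Gbc.
transitivity ((b (-1) * b (-1)) * ((q - 1) * G a * (c (-1) * q) * (a^-1)%g (1 - x) * E)).
  by ring.
by rewrite mcharN1_sqr -Gc; ring.
Qed.

(** * Pochhammer series as Gauss sum series, for a fixed [mu] *)

Lemma hyp_series_l a b c mu x :
  \sum_nu (poch psi a nu * poch psi c nu) / poch_o psi b (nu * mu)%g
     * (nu x / poch_o psi 1%g nu)
  = b (-1) * mu (-1) * Go b / (q * G a * G c) * hyp_gauss a c (b * mu)%g x.
Proof.
rewrite mulr_sumr; apply: eq_bigr => nu _.
have [q0 Ga Gc] := And3 card_field_neq0 (gauss_neq0 a) (gauss_neq0 c).
rewrite /poch /poch_o gauss_o1 mul1g !invf_div.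
rewrite [(Go (b * (nu * mu))%g)^-1]gauss_oV [(Go nu)^-1]gauss_oV.
rewrite (_ : b * (nu * mu) = b * mu * nu)%g; last by rewrite [(nu * mu)%g]mcharC mulgA.
rewrite !mcharM.
transitivity ((nu (-1) * nu (-1)) * (b (-1) * mu (-1) * Go b / (q * G a * G c) *
   (G (a * nu)%g * G (c * nu)%g * G ((b * mu * nu)^-1)%g * G (nu^-1)%g * nu x))).
  by field; rewrite q0 Ga Gc.
by rewrite mcharN1_sqr mul1r.
Qed.

(** After the shift [eta = nu * mu], reflection cancels the Gauss sums at [a * eta] and [eta^-1]
    between the inner and outer Pochhammer factors, and [(mu x)^-1] cancels the [mu x] split off
    from [eta x]. *)
Lemma hyp_series_r a b c mu x : x != 0 ->
  \sum_eta (poch psi a eta * poch psi c eta) / (poch_o psi b eta * poch_o psi 1%g eta)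
     * eta x * (poch psi (eta^-1)%g mu / poch_o psi ((a * eta)^-1)%g mu) * (mu x)^-1
  = b (-1) * mu (-1) * Go b / (q * G a * G c)
    * hyp_gauss a (c * mu)%g (b * mu)%g x.
Proof.
move=> x0; rewrite (reindex_inj (mulIg mu)) mulr_sumr; apply: eq_bigr => nu _.
have [q0 Ga Gc] := And3 card_field_neq0 (gauss_neq0 a) (gauss_neq0 c).
have mx : mu x != 0 by rewrite mchar_ext_eq0.
rewrite [(poch_o _ b _ * _)^-1]invfM /poch /poch_o gauss_o1 mul1g !invf_div.
have e1 : ((nu * mu)^-1 * mu = nu^-1)%g by rewrite mcharVM mulgKV.
have e2 : ((a * (nu * mu))^-1 * mu = (a * nu)^-1)%g.
  by rewrite [(a * _)%g]mulgA (mcharVM (a * nu)%g) mulgKV.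
rewrite e1 e2.
have GoV chi : Go (chi^-1)%g = chi (-1) * q / G chi.
  by rewrite -gaussV [G chi * _]mulrC mulfK ?gauss_neq0.
rewrite !GoV !gauss_oV.
have -> : (b * (nu * mu) = b * mu * nu)%g by rewrite [(nu * mu)%g]mcharC mulgA.
have -> : (c * (nu * mu) = c * mu * nu)%g by rewrite [(nu * mu)%g]mcharC mulgA.
rewrite !mcharM !invfM !invrK !mcharN1V.
have Gm := gauss_neq0 ((nu * mu)^-1)%g.
have Gam := gauss_neq0 (a * (nu * mu))%g.
transitivity ((a (-1) * a (-1)) * (nu (-1) * nu (-1)) * (nu (-1) * nu (-1))
  * (mu (-1) * mu (-1)) * (b (-1) * mu (-1) * Go b / (q * G a * G c) *
   (G (a * nu)%g * G (c * mu * nu)%g * G ((b * mu * nu)^-1)%g * G (nu^-1)%g * nu x))).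
  by field; rewrite q0 Ga Gc Gm Gam mx.
by rewrite !mcharN1_sqr !mul1r !invfM.
Qed.

(** This is the coefficient identity for one [mu]. The factor [poch psi (b * c^-1) mu] supplies the
    Gauss sum on the left of [hyp_gauss_pfaff], taken with [b * mu] in place of [b]. *)
Lemma hyp_series_pfaff a b c mu x :
  a != 1%g -> c != 1%g -> x != 0 -> x != 1 ->
  \sum_nu (poch psi a nu * poch psi c nu) / poch_o psi b (nu * mu)%g
     * (nu x / poch_o psi 1%g nu) * poch psi (b * c^-1)%g mu
  = (a^-1)%g (1 - x) * (\sum_eta (poch psi a eta * poch psi (b * c^-1)%g eta)
       / (poch_o psi b eta * poch_o psi 1%g eta) * eta (x / (x - 1))
       * (poch psi (eta^-1)%g mu / poch_o psi ((a * eta)^-1)%g mu)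
       * (mu (x / (x - 1)))^-1)
  + (q - 1) ^+ 2 * (c^-1)%g x * b (-1) * mu (-1) * Go b * poch psi a (c^-1)%g
     / (q * G (b * c^-1)%g) * (mu == b^-1 * c)%g%:R.
Proof.
move=> a1 c1 x0 x1; have x1' : x - 1 != 0 by rewrite subr_eq0.
rewrite -mulr_suml hyp_series_l hyp_series_r ?mulf_neq0 ?invr_eq0 //.
have -> : (b * c^-1 * mu = b * mu * c^-1)%g by rewrite -!mulgA [(mu * _)%g]mcharC.
have -> : (mu == b^-1 * c)%g = (b * mu == c)%g.
  by rewrite -(inj_eq (mulgI b)) mulKVg.
have [q0 Ga Gc] := And3 card_field_neq0 (gauss_neq0 a) (gauss_neq0 c).
have Gbc := gauss_neq0 (b * c^-1)%g.
have -> : poch psi (b * c^-1)%g mu = G (b * mu * c^-1)%g / G (b * c^-1)%g.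
  by rewrite /poch -!mulgA [(mu * _)%g]mcharC.
rewrite -mulrA [hyp_gauss _ _ _ _ * _]mulrA hyp_gauss_pfaff // /poch.
by field; rewrite q0 Ga Gc Gbc.
Qed.

(** * Assembling the double series *)

Lemma mpoch_pgenD a b nu :
  mpoch psi (pgen a + pgen b) nu = poch psi a nu * poch psi b nu.
Proof.
have pr1 chi : \prod_phi poch psi phi nu ^+ (pgen chi phi) = poch psi chi nu.
  rewrite (bigD1 chi) //= ffunE eqxx expr1 big1 ?mulr1 // => phi /negPf phi1.
  by rewrite ffunE phi1 expr0.
rewrite -!pr1 -big_split; apply: eq_bigr => phi _ /=.
by rewrite [(pgen a + pgen b) phi]ffunE exprD.
Qed.

Lemma mpoch_o_pgenD a b nu :
  mpoch_o psi (pgen a + pgen b) nu = poch_o psi a nu * poch_o psi b nu.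
Proof.
have pr1 chi : \prod_phi poch_o psi phi nu ^+ (pgen chi phi) = poch_o psi chi nu.
  rewrite (bigD1 chi) //= ffunE eqxx expr1 big1 ?mulr1 // => phi /negPf phi1.
  by rewrite ffunE phi1 expr0.
rewrite -!pr1 -big_split; apply: eq_bigr => phi _ /=.
by rewrite [(pgen a + pgen b) phi]ffunE exprD.
Qed.

Lemma hyp_double_series (alpha beta gamma : X) (f : X -> C) x y :
  alpha != 1%g -> gamma != 1%g -> x != 0 -> x != 1 ->
  \sum_(nu : X) \sum_(mu : X)
     f mu
     * ((poch psi alpha nu * poch psi gamma nu
           * poch psi (beta * gamma^-1)%g mu)
        / poch_o psi beta (nu * mu)%g)
     * ((nu x * mu y) / (poch_o psi 1%g nu * poch_o psi 1%g mu))
  = (alpha^-1)%g (1 - x)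
      * (\sum_(eta : X)
           mpoch psi (pgen alpha + pgen (beta * gamma^-1)%g) eta
           / mpoch_o psi (pgen beta + pgen 1%g) eta
           * eta (x / (x - 1))
           * \sum_(mu : X)
               f mu
               * (poch psi (eta^-1)%g mu
                  / mpoch_o psi
                      (pgen ((alpha * eta)^-1)%g + pgen 1%g) mu)
               * mu (y * (x - 1) / x))
    + (1 - #|F|%:R) ^+ 2 * f (beta^-1 * gamma)%g
      * poch_o psi 1%g beta * poch psi alpha (gamma^-1)%g
      * (beta^-1)%g (- y) * gamma (y / x).
Proof.
move=> a1 c1 x0 x1; have x1' : x - 1 != 0 by rewrite subr_eq0.
have pf mu := hyp_series_pfaff beta mu a1 c1 x0 x1.
rewrite exchange_big /=.
transitivity (\sum_mu f mu * (mu y / poch_o psi 1%g mu) *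
  \sum_nu (poch psi alpha nu * poch psi gamma nu) / poch_o psi beta (nu * mu)%g
     * (nu x / poch_o psi 1%g nu) * poch psi (beta * gamma^-1)%g mu).
  apply: eq_bigr => mu _; rewrite mulr_sumr; apply: eq_bigr => nu _.
  (* Abstracted because [ring] would otherwise unfold the Gauss sums. *)
  move: (poch_o psi beta _) (poch_o psi 1%g nu) (poch_o psi 1%g mu) => B' D M.
  move: (poch psi alpha _) (poch psi gamma _) (poch psi _ mu) => A B c.
  by rewrite !invfM; ring.
rewrite (eq_bigr _ (fun mu _ => congr1 _ (pf mu))).
under eq_bigr do rewrite mulrDr.
rewrite big_split /=; congr (_ + _).
  under [in RHS]eq_bigr do rewrite mulr_sumr.
  rewrite [in RHS]exchange_big mulr_sumr; apply: eq_bigr => mu _ /=.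
  rewrite mulrCA; congr (_ * _); rewrite mulr_sumr; apply: eq_bigr => eta _.
  rewrite mpoch_pgenD !mpoch_o_pgenD !mchar_extM !mchar_extV.
  move: (poch_o psi beta _) (poch_o psi 1%g eta) (poch_o psi 1%g mu) => B' D M.
  move: (poch psi alpha _) (poch psi (beta * _)%g eta) => A B.
  move: (poch psi _ mu) (poch_o _ _ _) => c E.
  by rewrite !invfM !invrK; ring.
(* The correction survives only at [mu = beta^-1 * gamma]. *)
rewrite (bigD1 (beta^-1 * gamma)%g) //= eqxx big1 ?addr0 => [|mu /negPf ->]; last first.
  by rewrite !mulr0.
have q0 := card_field_neq0.
have G0 := gauss_neq0 (beta * gamma^-1)%g.
have Go0 := gauss_o_neq0 (beta^-1 * gamma)%g.
(* These two Gauss sums are the denominators of the surviving term; reflection replaces them by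
   signs and [q]. *)
have GG : gauss psi (beta * gamma^-1)%g * gauss_o psi (beta^-1 * gamma)%g
    = beta (-1) * gamma (-1) * #|F|%:R.
  have := gaussV (beta * gamma^-1)%g.
  by rewrite mcharVM invgK mcharM mcharV mcharN1V.
rewrite /poch_o !mul1g gauss_o1 // invf_div [in RHS]mcharN.
rewrite !mcharM !mcharV mchar_extM mchar_extV mcharN1V.
have b0 : beta (-1) != 0 by rewrite mchar_ext_eq0 oppr_eq0 oner_eq0.
have c0 : gamma (-1) != 0 by rewrite mchar_ext_eq0 oppr_eq0 oner_eq0.
move: G0 Go0 GG b0 c0; move: (G _) (Go (_ * _)%g) (Go beta) (poch _ _ _) => g1 g2 g P.
move: (beta y)^-1 (gamma x)^-1 (gamma y) (beta (-1)) (gamma (-1)) (f _) => u v w b c z.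
move=> g10 g20 GG b0 c0.
transitivity ((q - 1) ^+ 2 * u * v * w * z * g * P * b * (b * c) / (g1 * g2)).
  by rewrite mulr1; field; rewrite q0 g10 g20.
by rewrite GG; field; rewrite q0 b0 c0.
Qed.

End GaussSums.

(** The pairing is a sum of natural numbers whose diagonal term at [chi] is [s chi * t chi]. *)
Lemma pairing_eq0_disjoint (F : finFieldType) (C : numClosedFieldType)
    (s t : charmon F C) (chi : mchar F C) :
  pairing s t = 0%N -> (0 < s chi)%N -> t chi = 0%N.
Proof.
move/eqP; rewrite sum_nat_eq0 => /forallP/(_ chi); rewrite implyTb.
rewrite sum_nat_eq0 => /forallP/(_ chi); rewrite implyTb.
by rewrite /delta mulgV eqxx muln1 muln_eq0 => /orP[/eqP->|/eqP].
Qed.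

Theorem theorem3p13 (R : realType) (F : finFieldType)
    (psi : F -> R[i]) (psi_char : is_additive_char psi)
    (psi_nontrivial : exists a : F, psi a <> 1)
    (alpha beta gamma : mchar F R[i])
    (h1 : pairing (pgen alpha + pgen gamma) (pgen 1%g) = 0%N)
    (h2 : pairing (pgen alpha) (pgen gamma) = 0%N)
    (f : mchar F R[i] -> R[i])
    (x y : F) (x_neq0 : x <> 0) (x_neq1 : x <> 1) :
  \sum_(nu : mchar F R[i]) \sum_(mu : mchar F R[i])
     f mu
     * ((poch psi alpha nu * poch psi gamma nu
           * poch psi (beta * gamma^-1)%g mu)
        / poch_o psi beta (nu * mu)%g)
     * ((nu x * mu y) / (poch_o psi 1%g nu * poch_o psi 1%g mu))
  = (alpha^-1)%g (1 - x)
      * (\sum_(eta : mchar F R[i])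
           mpoch psi (pgen alpha + pgen (beta * gamma^-1)%g) eta
           / mpoch_o psi (pgen beta + pgen 1%g) eta
           * eta (x / (x - 1))
           * \sum_(mu : mchar F R[i])
               f mu
               * (poch psi (eta^-1)%g mu
                  / mpoch_o psi
                      (pgen ((alpha * eta)^-1)%g + pgen 1%g) mu)
               * mu (y * (x - 1) / x))
    + (1 - #|F|%:R) ^+ 2 * f (beta^-1 * gamma)%g
      * poch_o psi 1%g beta * poch psi alpha (gamma^-1)%g
      * (beta^-1)%g (- y) * gamma (y / x).
Proof.
have x0 : x != 0 by apply/eqP.
have x1 : x != 1 by apply/eqP.
have a1 : alpha != 1%g.
  (* A trivial [alpha] would give the trivial character positive multiplicity in both arguments of
     [h1]. *)
  apply/eqP => e; have := pairing_eq0_disjoint h1 (chi := 1%g).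
  by rewrite !ffunE e eqxx => /(_ isT).
have c1 : gamma != 1%g.
  apply/eqP => e; have := pairing_eq0_disjoint h1 (chi := 1%g).
  by rewrite !ffunE e eqxx addrC => /(_ isT).
exact: hyp_double_series.
Qed.
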